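(* Let $q$ be a complex number with $|q|<1$. Then $$\sum_{n\ge 0} \frac{(-1)^n q^{3\binom{n}{2}+4n}(q;q^3)_n}{(q^9;q^9)_n} = \frac{(q^{4};q^{6})_\infty (q^{12};q^{18})_\infty}{(q^{5};q^{6})_\infty (q^{9};q^{18})_\infty}.$$
   Context: For $n\in\mathbb{N}\cup\{\infty\}$, the $q$-Pochhammer symbol is $(A;q)_n:=\prod_{k=0}^{n-1}(1-Aq^k)$ (with $(A;q)_0=1$). *)

(* Defs.v *)
From Stdlib Require Import Reals.
From Coquelicot Require Import Coquelicot.

Fixpoint binom (n k : nat) : nat :=
  match n, k with
  | _, O => 1
  | O, S _ => 0
  | S n', S k' => binom n' k' + binom n' k
  end.

Fixpoint qpoch (A q : C) (n : nat) : C :=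
  match n with
  | O => 1%C
  | S m => (qpoch A q m * (1 - A * q ^ m))%C
  end.

(* Coquelicot's [lim] is total: this is the limit of the partial products
   whenever they converge, as they do for every [A] when [Cmod q < 1]. *)
Definition qpoch_inf (A q : C) : C :=
  @lim C_CompleteNormedModule (filtermap (qpoch A q) eventually).

(* Main.v *)
Require Import Defs.
From Stdlib Require Import Reals Lra Lia.
From Coquelicot Require Import Coquelicot.

(** With [Q = q^3], the series is the case [x = q] of
    [T(x) = sum_n (-1)^n Q^(n(n-1)/2) (x Q)^n (x; Q)_n (Q^2/x; Q^2)_n
                  / ((Q^3; Q^3)_n (x^2 Q; Q^2)_n)],
    since [x^3 = Q] makes [(Q^2/x; Q^2)_n] and [(x^2 Q; Q^2)_n] cancel.  A q-WZ
    certificate gives the contiguous relation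
    [T(x) = (1 - x Q) (1 - x^3 Q^3) / ((1 - x^2 Q) (1 - x^2 Q^3)) T(x Q^2)].
    Iterating it and using continuity at [x = 0],
    [T(x) (x^2 Q; Q^2)_oo = (x Q; Q^2)_oo (x^3 Q^3; Q^6)_oo T(0)], and [T(0)] is read
    off from the trivial value [T(1) = 1]. *)

Open Scope C_scope.

(** * Convergence of complex sequences *)

(** Stated through the real sequence of moduli, so that squeeze and comparison results for real
    limits apply directly. *)
Definition Ccv (u : nat -> C) (l : C) : Prop :=
  is_lim_seq (fun n => Cmod (u n - l)) 0%R.

Lemma Ccv_filterlim (u : nat -> C) (l : C) :
  Ccv u l <-> filterlim u eventually (locally (T := C_NormedModule) l).
Proof.
  unfold Ccv.
  rewrite (filterlim_locally_ball_norm (K := C_AbsRing) (U := C_NormedModule)).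
  split; intros H.
  - intros eps. apply is_lim_seq_spec in H. destruct (H eps) as [N HN].
    exists N. intros n Hn. specialize (HN n Hn).
    rewrite Rminus_0_r, Rabs_pos_eq in HN by apply Cmod_ge_0. exact HN.
  - apply is_lim_seq_spec. intros eps. destruct (H eps) as [N HN].
    exists N. intros n Hn. specialize (HN n Hn).
    rewrite Rminus_0_r, Rabs_pos_eq by apply Cmod_ge_0. exact HN.
Qed.

Lemma Ccv_unique (u : nat -> C) (l m : C) : Ccv u l -> Ccv u m -> l = m.
Proof.
  intros Hl Hm. apply Ccv_filterlim in Hl. apply Ccv_filterlim in Hm.
  exact (filterlim_locally_unique (V := C_NormedModule) u l m Hl Hm).
Qed.

(** A convergent sequence generates a Cauchy filter, and by completeness the total function [lim] is
    then a genuine limit of it. This gives meaning to [qpoch_inf] and [cubic_sum]. *)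
Lemma Ccv_lim (u : nat -> C) (l : C) :
  Ccv u l -> Ccv u (@lim C_CompleteNormedModule (filtermap u eventually)).
Proof.
  intros Hl. apply Ccv_filterlim.
  apply (filterlim_locally (U := C_CompleteNormedModule)). intros eps.
  apply (complete_cauchy (T := C_CompleteNormedModule) (filtermap u eventually)).
  - apply filtermap_proper_filter, eventually_filter.
  - intros e. exists l. apply Ccv_filterlim in Hl.
    apply (proj1 (filterlim_locally (U := C_NormedModule) u l) Hl e).
Qed.

Lemma Ccv_squeeze (u : nat -> C) (l : C) (b : nat -> R) :
  (forall n, (Cmod (u n - l) <= b n)%R) -> is_lim_seq b 0%R -> Ccv u l.
Proof.
  intros H Hb. apply is_lim_seq_le_le with (u := fun _ => 0%R) (w := b).
  - intros n. split; [apply Cmod_ge_0 | apply H].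
  - apply is_lim_seq_const.
  - exact Hb.
Qed.

Lemma Ccv_ext (u v : nat -> C) (l : C) :
  (forall n, u n = v n) -> Ccv u l -> Ccv v l.
Proof.
  intros H. apply is_lim_seq_ext. intros n. now rewrite H.
Qed.

Lemma Ccv_mult (u v : nat -> C) (l m : C) :
  Ccv u l -> Ccv v m -> Ccv (fun n => u n * v n) (l * m).
Proof.
  intros Hu Hv.
  apply Ccv_squeeze with (b := fun n =>
    (Cmod (u n - l) * Cmod (v n - m) + Cmod l * Cmod (v n - m)
       + Cmod m * Cmod (u n - l))%R).
  - intros n. rewrite <- !Cmod_mult.
    replace (u n * v n - l * m)
      with ((u n - l) * (v n - m) + l * (v n - m) + m * (u n - l)) by ring.
    eapply Rle_trans; [apply Cmod_triangle|]. apply Rplus_le_compat_r, Cmod_triangle.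
  - replace (Finite 0) with (Finite (0 * 0 + Cmod l * 0 + Cmod m * 0)%R)
      by (f_equal; ring).
    apply is_lim_seq_plus'; [apply is_lim_seq_plus'|].
    + now apply is_lim_seq_mult'.
    + apply is_lim_seq_mult'; [apply is_lim_seq_const | exact Hv].
    + apply is_lim_seq_mult'; [apply is_lim_seq_const | exact Hu].
Qed.

Lemma Ccv_plus (u v : nat -> C) (l m : C) :
  Ccv u l -> Ccv v m -> Ccv (fun n => u n + v n) (l + m).
Proof.
  intros Hu Hv.
  apply Ccv_squeeze with (b := fun n => (Cmod (u n - l) + Cmod (v n - m))%R).
  - intros n. replace (u n + v n - (l + m)) with ((u n - l) + (v n - m)) by ring.
    apply Cmod_triangle.
  - replace (Finite 0) with (Finite (0 + 0)%R) by (f_equal; ring).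
    now apply is_lim_seq_plus'.
Qed.

Lemma Ccv_const (c : C) : Ccv (fun _ => c) c.
Proof.
  apply Ccv_squeeze with (b := fun _ => 0%R); [|apply is_lim_seq_const].
  intros _. replace (c - c) with (RtoC 0) by ring. rewrite Cmod_0. lra.
Qed.

(** Used because iterating the contiguous relation meets the product $(x^2Q;Q^2)_\infty$ only at
    even lengths. *)
Lemma Ccv_double (u : nat -> C) (l : C) :
  Ccv u l -> Ccv (fun n => u (2 * n)%nat) l.
Proof.
  intros H. apply (is_lim_seq_subseq (fun n => Cmod (u n - l)) _ (fun n => (2 * n)%nat));
    [|exact H].
  apply eventually_subseq. intros n. lia.
Qed.

Lemma Ccv_of_majorant (a : nat -> C) (b : nat -> R) :
  (forall n, (Cmod (a n) <= b n)%R) -> ex_series b ->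
  exists l, Ccv (sum_n (G := C_NormedModule) a) l.
Proof.
  intros H Hb.
  destruct (ex_series_le (V := C_CompleteNormedModule) a b H Hb) as [l Hl].
  exists l. apply Ccv_filterlim, Hl.
Qed.

Lemma sum_n_Cmod_le (a : nat -> C) (b : nat -> R) (n : nat) :
  (forall k, (Cmod (a k) <= b k)%R) ->
  (Cmod (sum_n (G := C_NormedModule) a n) <= sum_n b n)%R.
Proof.
  intros H. induction n as [|n IH].
  - rewrite !sum_O. apply H.
  - rewrite !sum_Sn. eapply Rle_trans; [apply Cmod_triangle|].
    apply Rplus_le_compat; [exact IH | apply H].
Qed.

Lemma Cmod_Ccv_le (u : nat -> C) (l : C) (M : R) :
  Ccv u l -> (forall n, (Cmod (u n) <= M)%R) -> (Cmod l <= M)%R.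
Proof.
  intros Hu HM.
  apply (is_lim_seq_le (fun _ => Cmod l) (fun n => (M + Cmod (u n - l))%R) (Cmod l) M).
  - intros n. replace l with (u n + - (u n - l)) at 1 by ring.
    eapply Rle_trans; [apply Cmod_triangle|].
    rewrite Cmod_opp. apply Rplus_le_compat_r, HM.
  - apply is_lim_seq_const.
  - replace (Finite M) with (Finite (M + 0)%R) by (f_equal; ring).
    apply is_lim_seq_plus'; [apply is_lim_seq_const | exact Hu].
Qed.

(** * Modulus estimates in the unit disc *)

Lemma Cmod_one_minus_ge (z : C) : (1 - Cmod z <= Cmod (1 - z))%R.
Proof.
  assert (H := Cmod_triangle (1 - z) z).
  replace (1 - z + z) with (RtoC 1) in H by ring.
  rewrite Cmod_1 in H. lra.
Qed.

Lemma Cmod_one_minus_le (z : C) : (Cmod z <= 1 -> Cmod (1 - z) <= 2)%R.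
Proof.
  intros H. unfold Cminus. eapply Rle_trans; [apply Cmod_triangle|].
  rewrite Cmod_1, Cmod_opp. lra.
Qed.

Lemma one_minus_neq0 (z : C) : (Cmod z < 1)%R -> 1 - z <> 0.
Proof.
  intros H E. assert (G := Cmod_one_minus_ge z). rewrite E, Cmod_0 in G. lra.
Qed.

Lemma Cmod_mult_le1 (a b : C) :
  (Cmod a <= 1 -> Cmod b <= 1 -> Cmod (a * b) <= 1)%R.
Proof.
  intros Ha Hb. rewrite Cmod_mult.
  assert (A := Cmod_ge_0 a). assert (B := Cmod_ge_0 b). nra.
Qed.

Lemma Cmod_mult_lt1 (a b : C) :
  (Cmod a < 1 -> Cmod b <= 1 -> Cmod (a * b) < 1)%R.
Proof.
  intros Ha Hb. rewrite Cmod_mult.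
  assert (A := Cmod_ge_0 a). assert (B := Cmod_ge_0 b). nra.
Qed.

Lemma Cmod_pow_le1 (a : C) (n : nat) : (Cmod a <= 1 -> Cmod (a ^ n) <= 1)%R.
Proof.
  intros Ha. rewrite Cmod_pow. rewrite <- (pow1 n).
  apply pow_incr. split; [apply Cmod_ge_0 | exact Ha].
Qed.

Lemma Cmod_pow_lt1 (a : C) (n : nat) : (Cmod a < 1 -> Cmod (a ^ S n) < 1)%R.
Proof.
  intros Ha. rewrite Cpow_S.
  apply Cmod_mult_lt1; [exact Ha|]. apply Cmod_pow_le1. lra.
Qed.

(** * Infinite products *)

(** Since $1+t\le e^t$, the growth factors multiply to at most the exponential of a geometric sum.
    It serves both for the partial products and for their inverses. *)
Lemma geometric_growth_bound (c r : R) (w : nat -> R) (n : nat) :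
  (0 <= c -> 0 <= r < 1 -> w 0%nat = 1 -> (forall k, 0 <= w k) ->
   (forall k, w (S k) <= w k * (1 + c * r ^ k)) ->
   w n <= exp (c / (1 - r)))%R.
Proof.
  intros Hc Hr H0 Hpos Hstep.
  (* The induction needs the exact partial geometric sum in the exponent; the full sum is not
     inductive. *)
  assert (Hn : (w n <= exp (c * (1 - r ^ n) / (1 - r)))%R).
  { induction n as [|n IH].
    - rewrite H0. simpl. replace (c * (1 - 1) / (1 - r))%R with 0%R by (field; lra).
      rewrite exp_0. lra.
    - eapply Rle_trans; [apply Hstep|].
      replace (c * (1 - r ^ S n) / (1 - r))%R
        with (c * (1 - r ^ n) / (1 - r) + c * r ^ n)%R by (simpl; field; lra).
      rewrite exp_plus.
      assert (0 <= r ^ n)%R by (apply pow_le; lra).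
      apply Rmult_le_compat; [apply Hpos | nra | exact IH | apply exp_ineq1_le]. }
  eapply Rle_trans; [exact Hn|].
  assert (Hle : (c * (1 - r ^ n) / (1 - r) <= c / (1 - r))%R).
  { unfold Rdiv. apply Rmult_le_compat_r; [apply Rlt_le, Rinv_0_lt_compat; lra|].
    assert (0 <= r ^ n)%R by (apply pow_le; lra). nra. }
  destruct Hle as [Hlt | ->]; [apply Rlt_le, exp_increasing, Hlt | apply Rle_refl].
Qed.

(** Consecutive partial products differ by $-ab^n$ times a bounded quantity, so their differences
    form an absolutely convergent series. *)
Lemma qpoch_Ccv (a b : C) : (Cmod b < 1)%R -> Ccv (qpoch a b) (qpoch_inf a b).
Proof.
  intros Hb.
  assert (B0 := Cmod_ge_0 b). assert (A0 := Cmod_ge_0 a).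
  set (M := exp (Cmod a / (1 - Cmod b))).
  assert (HM : forall n, (Cmod (qpoch a b n) <= M)%R).
  { intros n. apply (geometric_growth_bound _ _ (fun k => Cmod (qpoch a b k))).
    - exact A0.
    - lra.
    - simpl. apply Cmod_1.
    - intros k. apply Cmod_ge_0.
    - intros k. simpl. rewrite Cmod_mult. apply Rmult_le_compat_l; [apply Cmod_ge_0|].
      unfold Cminus. eapply Rle_trans; [apply Cmod_triangle|].
      rewrite Cmod_1, Cmod_opp, Cmod_mult, Cmod_pow. apply Rle_refl. }
  destruct (Ccv_of_majorant (fun n => qpoch a b n * - (a * b ^ n))
              (fun n => (M * Cmod a * Cmod b ^ n)%R)) as [l Hl].
  - intros n. rewrite Cmod_mult, Cmod_opp, Cmod_mult, Cmod_pow, Rmult_assoc.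
    apply Rmult_le_compat_r; [|apply HM].
    apply Rmult_le_pos; [exact A0 | now apply pow_le].
  - apply (ex_series_scal (K := R_AbsRing) (V := R_NormedModule)).
    apply ex_series_geom. rewrite Rabs_pos_eq; assumption.
  - apply (Ccv_lim (qpoch a b) (1 + l)).
    (* The differences of index $0,\dots,n$ add up to the product of $n+1$ factors minus 1, hence
       the shift by one. *)
    apply is_lim_seq_incr_1.
    apply (is_lim_seq_ext (fun n =>
      Cmod (sum_n (G := C_NormedModule) (fun n => qpoch a b n * - (a * b ^ n)) n - l)));
      [|exact Hl].
    intros n. f_equal.
    replace (qpoch a b (S n))
      with (1 + sum_n (G := C_NormedModule) (fun n => qpoch a b n * - (a * b ^ n)) n);
      [ring|].
    induction n as [|n IH].
    + rewrite sum_O. simpl. ring.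
    + rewrite sum_Sn. change plus with Cplus. rewrite Cplus_assoc, IH. simpl. ring.
Qed.

Lemma qpoch_neq0 (a b : C) (n : nat) :
  (Cmod a < 1)%R -> (Cmod b < 1)%R -> qpoch a b n <> 0.
Proof.
  intros Ha Hb. induction n as [|n IH]; simpl.
  - apply C1_nz.
  - apply Cmult_neq_0; [exact IH|]. apply one_minus_neq0.
    apply Cmod_mult_lt1; [exact Ha|]. apply Cmod_pow_le1. lra.
Qed.

(** The inverses of the partial products stay below a constant $M$, so the moduli stay above $1/M$
    and cannot tend to 0. The growth bound applies because $1/(1-|a|s)\le 1+\frac{|a|}{1-|a|}s$ for
    $0\le s\le 1$. *)
Lemma qpoch_inf_neq0 (a b : C) :
  (Cmod a < 1)%R -> (Cmod b < 1)%R -> qpoch_inf a b <> 0.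
Proof.
  intros Ha Hb E.
  assert (B0 := Cmod_ge_0 b). assert (A0 := Cmod_ge_0 a).
  assert (Hc : (0 <= Cmod a / (1 - Cmod a))%R).
  { unfold Rdiv. apply Rmult_le_pos; [exact A0|]. apply Rlt_le, Rinv_0_lt_compat. lra. }
  set (M := exp (Cmod a / (1 - Cmod a) / (1 - Cmod b))).
  assert (MP : (0 < M)%R) by apply exp_pos.
  assert (PP : forall n, (0 < Cmod (qpoch a b n))%R).
  { intros n. apply Cmod_gt_0. now apply qpoch_neq0. }
  assert (HM : forall n, (/ Cmod (qpoch a b n) <= M)%R).
  { intros n. apply (geometric_growth_bound _ _ (fun k => (/ Cmod (qpoch a b k))%R)).
    - exact Hc.
    - lra.
    - simpl. rewrite Cmod_1. apply Rinv_1.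
    - intros k. apply Rlt_le, Rinv_0_lt_compat, PP.
    - intros k. simpl. rewrite Cmod_mult, Rinv_mult.
      apply Rmult_le_compat_l; [apply Rlt_le, Rinv_0_lt_compat, PP|].
      assert (G := Cmod_one_minus_ge (a * b ^ k)). rewrite Cmod_mult, Cmod_pow in G.
      set (s := (Cmod b ^ k)%R) in *.
      assert (Hs : (0 <= s <= 1)%R).
      { unfold s. split; [now apply pow_le|]. rewrite <- (pow1 k).
        apply pow_incr. lra. }
      apply Rle_trans with (/ (1 - Cmod a * s))%R.
      + apply Rinv_le_contravar; [nra | exact G].
      + assert (D : (0 < 1 - Cmod a * s)%R) by nra.
        apply Rmult_le_reg_r with ((1 - Cmod a * s) * (1 - Cmod a))%R; [nra|].
        replace (/ (1 - Cmod a * s) * ((1 - Cmod a * s) * (1 - Cmod a)))%R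
          with (1 - Cmod a)%R by (field; lra).
        replace ((1 + Cmod a / (1 - Cmod a) * s) * ((1 - Cmod a * s) * (1 - Cmod a)))%R
          with ((1 - Cmod a + Cmod a * s) * (1 - Cmod a * s))%R by (field; lra).
        (* After clearing denominators, this product is exactly the difference of the two sides. *)
        assert (0 <= Cmod a * s * (Cmod a * (1 - s)))%R.
        { apply Rmult_le_pos; apply Rmult_le_pos; lra. }
        nra. }
  assert (L := qpoch_Ccv a b Hb). rewrite E in L.
  assert (Hle : (/ M <= 0)%R).
  { apply (is_lim_seq_le (fun _ => (/ M)%R) (fun n => Cmod (qpoch a b n - 0)) (/ M)%R 0%R).
    - intros n. replace (qpoch a b n - 0) with (qpoch a b n) by ring.
      rewrite <- (Rinv_inv (Cmod (qpoch a b n))).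
      apply Rinv_le_contravar; [apply Rinv_0_lt_compat, PP | apply HM].
    - apply is_lim_seq_const.
    - exact L. }
  assert (0 < / M)%R by now apply Rinv_0_lt_compat. lra.
Qed.

(** * The cubic series *)

(* [cubic_term Q x n] is
   [(-1)^n Q^(n(n-1)/2) (x Q)^n (x; Q)_n (Q^2/x; Q^2)_n / ((Q^3; Q^3)_n (x^2 Q; Q^2)_n)],
   written as a product of successive ratios so that [x = 0] is allowed. *)
Definition cubic_ratio (Q x y : C) : C :=
  - (Q * y) * (1 - x * y) * (x - (Q * y) ^ 2)
  / ((1 - (Q * y) ^ 3) * (1 - x ^ 2 * Q * y ^ 2)).

Fixpoint cubic_term (Q x : C) (n : nat) : C :=
  match n with
  | O => 1
  | S m => cubic_term Q x m * cubic_ratio Q x (Q ^ m)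
  end.

Definition cubic_sum (Q x : C) : C :=
  @lim C_CompleteNormedModule
    (filtermap (sum_n (G := C_NormedModule) (cubic_term Q x)) eventually).

Definition cubic_factor (Q x : C) : C :=
  (1 - x * Q) * (1 - x ^ 3 * Q ^ 3) / ((1 - x ^ 2 * Q) * (1 - x ^ 2 * Q ^ 3)).

Section CubicSeries.

Variable Q : C.
Hypothesis HQ : (Cmod Q < 1)%R.

Lemma one_minus_Q_neq0 (z : C) : (Cmod z <= 1)%R -> 1 - Q * z <> 0.
Proof.
  intros Hz. apply one_minus_neq0. now apply Cmod_mult_lt1.
Qed.

Lemma Cmod_one_minus_Q_ge (z : C) :
  (Cmod z <= 1)%R -> (1 - Cmod Q <= Cmod (1 - Q * z))%R.
Proof.
  intros Hz. assert (H := Cmod_one_minus_ge (Q * z)). rewrite Cmod_mult in H.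
  assert (Q0 := Cmod_ge_0 Q). assert (Z0 := Cmod_ge_0 z). nra.
Qed.

Lemma Cmod_Qpow_le1 (n : nat) : (Cmod (Q ^ n) <= 1)%R.
Proof. apply Cmod_pow_le1. lra. Qed.

Ltac le1 := repeat first
  [ assumption | apply Cmod_mult_le1 | apply Cmod_Qpow_le1
  | apply Cmod_pow_le1 | (apply Rlt_le; assumption) | (rewrite Cmod_1; lra) ].

(** Each denominator factor has the form $1-Qz$ with $|z|\le 1$, hence is nonzero. The witness $z$
    is supplied by hand and its bound is left to [le1]. *)
Ltac neq e z := let H := fresh "N" in
  assert (H : e <> 0);
  [replace e with (1 - Q * z) by ring; apply one_minus_Q_neq0; le1|].

Ltac field_neq := field; repeat split; first
  [ assumption | apply C1_nz
  | let H := fresh in intros H;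
    match goal with N : _ <> _ |- _ => apply N; rewrite <- H; ring end ].

(** * The contiguous relation for partial sums *)

(** Replacing $x$ by $xQ^2$ turns $(Q^2/x;Q^2)_{n+1}$ into $(1-1/x)(Q^2/x;Q^2)_n$. Pairing index
    $n+1$ with index $n$ therefore leaves no factor $x-Q^{2j}$ in the denominator, and $1-1/x$
    cancels against the $1-x$ of $(x;Q)_n$. *)
Lemma cubic_term_shift (x : C) (n : nat) (y := Q ^ n) :
  (Cmod x <= 1)%R ->
  cubic_term Q (x * Q ^ 2) (S n) =
  Q ^ 3 * y ^ 3 * (1 - x * y) * (1 - x * Q * y) * (1 - x * Q ^ 2 * y)
    * (1 - x ^ 2 * Q) * (1 - x ^ 2 * Q ^ 3)
  / ((1 - x * Q) * (1 - x ^ 2 * Q * y ^ 2) * (1 - x ^ 2 * Q ^ 3 * y ^ 2)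
      * (1 - x ^ 2 * Q ^ 5 * y ^ 2) * (1 - Q ^ 3 * y ^ 3)) * cubic_term Q x n.
Proof.
  intros Hx. unfold y; clear y.
  neq (1 - x ^ 2 * Q) (x ^ 2). neq (1 - x ^ 2 * Q ^ 3) (x ^ 2 * Q * Q). neq (1 - x * Q) x.
  induction n as [|n IH].
  - simpl cubic_term. change (Q ^ 0) with (RtoC 1). unfold cubic_ratio.
    neq (1 - x ^ 2 * Q ^ 5) (x ^ 2 * Q * Q * Q * Q). neq (1 - Q ^ 3) (Q * Q).
    field_neq.
  - change (cubic_term Q (x * Q ^ 2) (S (S n)))
      with (cubic_term Q (x * Q ^ 2) (S n) * cubic_ratio Q (x * Q ^ 2) (Q ^ S n)).
    rewrite IH.
    change (cubic_term Q x (S n)) with (cubic_term Q x n * cubic_ratio Q x (Q ^ n)).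
    rewrite !(Cpow_S Q n). assert (Hy := Cmod_Qpow_le1 n).
    set (y := Q ^ n) in *. clearbody y. unfold cubic_ratio.
    neq (1 - x ^ 2 * Q * y ^ 2) (x ^ 2 * y ^ 2).
    neq (1 - x ^ 2 * Q ^ 3 * y ^ 2) (x ^ 2 * Q * Q * y ^ 2).
    neq (1 - x ^ 2 * Q ^ 5 * y ^ 2) (x ^ 2 * Q * Q * Q * Q * y ^ 2).
    neq (1 - x ^ 2 * Q ^ 7 * y ^ 2) (x ^ 2 * Q * Q * Q * Q * Q * Q * y ^ 2).
    neq (1 - Q ^ 3 * y ^ 3) (Q * Q * y ^ 3).
    neq (1 - Q ^ 6 * y ^ 3) (Q * Q * Q * Q * Q * y ^ 3).
    field_neq.
Qed.

(* The right-hand side is the q-WZ certificate of the contiguous relation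
   [cubic_sum_step]. *)
Lemma cubic_telescope (x : C) (n : nat) (y := Q ^ n) :
  (Cmod x <= 1)%R ->
  sum_n (G := C_NormedModule) (cubic_term Q x) n
    - cubic_factor Q x * sum_n (G := C_NormedModule) (cubic_term Q (x * Q ^ 2)) n =
  x * Q * y * (1 - x * y) * (1 - x * Q ^ 2 * y)
  / ((1 - x ^ 2 * Q * y ^ 2) * (1 - x ^ 2 * Q ^ 3 * y ^ 2)) * cubic_term Q x n.
Proof.
  intros Hx. unfold y; clear y. unfold cubic_factor.
  neq (1 - x ^ 2 * Q) (x ^ 2). neq (1 - x ^ 2 * Q ^ 3) (x ^ 2 * Q * Q). neq (1 - x * Q) x.
  induction n as [|n IH].
  - rewrite !sum_O. simpl cubic_term. change (Q ^ 0) with (RtoC 1).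
    field_neq.
  - rewrite !sum_Sn. change plus with Cplus.
    (* The difference of the sums up to $n$ is isolated and replaced by the certificate. Both new
       terms are rational multiples of [cubic_term Q x n], so a rational identity in $x$, $Q$ and
       $y=Q^n$ remains. *)
    match goal with |- ?s + ?t - ?r * (?s' + ?t') = ?e =>
      replace (s + t - r * (s' + t')) with ((s - r * s') + t - r * t') by ring end.
    rewrite IH, cubic_term_shift by exact Hx.
    change (cubic_term Q x (S n)) with (cubic_term Q x n * cubic_ratio Q x (Q ^ n)).
    rewrite !(Cpow_S Q n). assert (Hy := Cmod_Qpow_le1 n).
    set (y := Q ^ n) in *. clearbody y. unfold cubic_ratio.
    neq (1 - x ^ 2 * Q * y ^ 2) (x ^ 2 * y ^ 2).
    neq (1 - x ^ 2 * Q ^ 3 * y ^ 2) (x ^ 2 * Q * Q * y ^ 2).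
    neq (1 - x ^ 2 * Q ^ 5 * y ^ 2) (x ^ 2 * Q * Q * Q * Q * y ^ 2).
    neq (1 - Q ^ 3 * y ^ 3) (Q * Q * y ^ 3).
    field_neq.
Qed.

(** * Bounds uniform in $x$ on the closed unit disc *)

(** Both estimates concern $-Qy\,m$ over the same denominator, of modulus at least $(1-|Q|)^2$, with
    $|m|\le 4$. For the difference, $x$ factors out of the numerator, which gives a Lipschitz bound
    at $x=0$. *)
Lemma Cmod_cubic_ratio (x y : C) :
  (Cmod x <= 1)%R -> (Cmod y <= 1)%R ->
  (Cmod (cubic_ratio Q x y) <= 4 / (1 - Cmod Q) ^ 2 * Cmod y)%R /\
  (Cmod (cubic_ratio Q x y - cubic_ratio Q 0 y)
     <= Cmod x * (4 / (1 - Cmod Q) ^ 2 * Cmod y))%R.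
Proof.
  intros Hx Hy. assert (Q0 := Cmod_ge_0 Q). assert (Y0 := Cmod_ge_0 y).
  assert (X0 := Cmod_ge_0 x).
  neq (1 - (Q * y) ^ 3) (Q * Q * y ^ 3). neq (1 - x ^ 2 * Q * y ^ 2) (x ^ 2 * y ^ 2).
  assert (D : (Cmod (/ ((1 - (Q * y) ^ 3) * (1 - x ^ 2 * Q * y ^ 2)))
               <= / (1 - Cmod Q) ^ 2)%R).
  { rewrite Cmod_inv by now apply Cmult_neq_0.
    apply Rinv_le_contravar; [apply pow_lt; lra|].
    rewrite Cmod_mult. simpl (_ ^ 2)%R. rewrite Rmult_1_r.
    apply Rmult_le_compat; try lra.
    - replace ((Q * y) ^ 3) with (Q * (Q * Q * y ^ 3)) by ring. apply Cmod_one_minus_Q_ge; le1.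
    - replace (x ^ 2 * Q * y ^ 2) with (Q * (x ^ 2 * y ^ 2)) by ring. apply Cmod_one_minus_Q_ge; le1. }
  assert (I0 : (0 < / (1 - Cmod Q) ^ 2)%R) by (apply Rinv_0_lt_compat, pow_lt; lra).
  assert (E : forall n : C, (Cmod n <= 4)%R ->
    (Cmod (- (Q * y) * n / ((1 - (Q * y) ^ 3) * (1 - x ^ 2 * Q * y ^ 2)))
       <= 4 / (1 - Cmod Q) ^ 2 * Cmod y)%R).
  { intros n Hn. unfold Cdiv, Rdiv. rewrite Cmod_mult, Cmod_mult, Cmod_opp, Cmod_mult.
    replace (4 * / (1 - Cmod Q) ^ 2 * Cmod y)%R
      with (1 * Cmod y * 4 * / (1 - Cmod Q) ^ 2)%R by ring.
    assert (P0 := Cmod_ge_0 n).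
    apply Rmult_le_compat; [|apply Cmod_ge_0| |exact D].
    - apply Rmult_le_pos; [|exact P0]. now apply Rmult_le_pos.
    - apply Rmult_le_compat; [now apply Rmult_le_pos | exact P0 | | exact Hn].
      apply Rmult_le_compat_r; lra. }
  split.
  - unfold cubic_ratio. rewrite <- Cmult_assoc. apply E. rewrite Cmod_mult.
    assert (A : (Cmod (1 - x * y) <= 2)%R) by (apply Cmod_one_minus_le; le1).
    assert (B : (Cmod (x - (Q * y) ^ 2) <= 2)%R).
    { unfold Cminus. eapply Rle_trans; [apply Cmod_triangle|]. rewrite Cmod_opp.
      assert (Cmod ((Q * y) ^ 2) <= 1)%R by le1. lra. }
    assert (A0 := Cmod_ge_0 (1 - x * y)). assert (B0 := Cmod_ge_0 (x - (Q * y) ^ 2)). nra.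
  - replace (cubic_ratio Q x y - cubic_ratio Q 0 y)
      with (x * (- (Q * y) * (1 - x * y + (Q * y) ^ 2 * y * (1 - x * Q * y))
                 / ((1 - (Q * y) ^ 3) * (1 - x ^ 2 * Q * y ^ 2)))).
    + rewrite Cmod_mult. apply Rmult_le_compat_l; [exact X0|]. apply E.
      eapply Rle_trans; [apply Cmod_triangle|].
      assert (A : (Cmod (1 - x * y) <= 2)%R) by (apply Cmod_one_minus_le; le1).
      assert (B : (Cmod (1 - x * Q * y) <= 2)%R) by (apply Cmod_one_minus_le; le1).
      assert (C1 : (Cmod ((Q * y) ^ 2 * y) <= 1)%R) by le1.
      rewrite Cmod_mult. assert (B0 := Cmod_ge_0 (1 - x * Q * y)).
      assert (C0 := Cmod_ge_0 ((Q * y) ^ 2 * y)). nra.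
    + unfold cubic_ratio. field_neq.
Qed.

(** A ratio between $|Q|$ and 1 that stays positive at $Q=0$, so that the majorant never vanishes.
    The constant 8 in [M] doubles the 4 of [Cmod_cubic_ratio], which leaves room for the two terms
    of a product rule. *)
Let r := ((1 + Cmod Q) / 2)%R.
Let M := (8 / (1 - Cmod Q) ^ 2)%R.

Fixpoint cubic_majorant (n : nat) : R :=
  match n with
  | O => 1
  | S m => cubic_majorant m * (M * r ^ m)
  end%R.

Lemma r_bounds : (0 < r < 1)%R /\ (Cmod Q <= r)%R.
Proof. assert (Q0 := Cmod_ge_0 Q). unfold r. lra. Qed.

Lemma M_pos : (0 < M)%R.
Proof.
  unfold M, Rdiv. apply Rmult_lt_0_compat; [lra|]. apply Rinv_0_lt_compat, pow_lt. lra.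
Qed.

Lemma cubic_majorant_pos (n : nat) : (0 < cubic_majorant n)%R.
Proof.
  induction n as [|n IH]; simpl; [lra|].
  apply Rmult_lt_0_compat; [exact IH|]. apply Rmult_lt_0_compat; [apply M_pos|].
  apply pow_lt, r_bounds.
Qed.

(** Consecutive terms have ratio $Mr^n$, which tends to 0 whatever the size of $M$. *)
Lemma ex_series_cubic_majorant : ex_series cubic_majorant.
Proof.
  apply ex_series_ext with (a := fun n => Rabs (cubic_majorant n)).
  { intros n. apply Rabs_pos_eq, Rlt_le, cubic_majorant_pos. }
  apply ex_series_DAlembert with 0%R; [lra| |].
  - intros n. apply Rgt_not_eq, cubic_majorant_pos.
  - apply is_lim_seq_ext with (u := fun n => (M * r ^ n)%R).
    + intros n. assert (P := cubic_majorant_pos n). simpl.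
      replace (cubic_majorant n * (M * r ^ n) / cubic_majorant n)%R
        with (M * r ^ n)%R by (field; lra).
      rewrite Rabs_pos_eq; [reflexivity|].
      apply Rmult_le_pos; [apply Rlt_le, M_pos|]. apply pow_le. apply Rlt_le, r_bounds.
    + replace (Finite 0) with (Rbar_mult (Finite M) (Finite 0))
        by (simpl; f_equal; ring).
      apply is_lim_seq_scal_l, is_lim_seq_geom.
      rewrite Rabs_pos_eq; [|apply Rlt_le]; apply r_bounds.
Qed.

Lemma cubic_term_bounds (x : C) (n : nat) : (Cmod x <= 1)%R ->
  (Cmod (cubic_term Q x n) <= cubic_majorant n)%R /\
  (Cmod (cubic_term Q x n - cubic_term Q 0 n) <= Cmod x * cubic_majorant n)%R.
Proof.
  intros Hx. assert (X0 := Cmod_ge_0 x). induction n as [|n [IH1 IH2]].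
  - simpl. rewrite Cmod_1. replace (1 - 1) with (RtoC 0) by ring. rewrite Cmod_0. lra.
  - simpl. destruct (Cmod_cubic_ratio x (Q ^ n) Hx (Cmod_Qpow_le1 n)) as [R1 R2].
    assert (Hq : (Cmod (Q ^ n) <= r ^ n)%R).
    { rewrite Cmod_pow. apply pow_incr. split; [apply Cmod_ge_0 | apply r_bounds]. }
    assert (Hk : (4 / (1 - Cmod Q) ^ 2 * Cmod (Q ^ n) <= M * r ^ n / 2)%R).
    { replace (M * r ^ n / 2)%R with (4 / (1 - Cmod Q) ^ 2 * r ^ n)%R
        by (unfold M; field; lra).
      apply Rmult_le_compat_l; [|exact Hq]. assert (P := M_pos). unfold M in P.
      replace (4 / (1 - Cmod Q) ^ 2)%R with (8 / (1 - Cmod Q) ^ 2 / 2)%R by (field; lra).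
      lra. }
    set (k := (4 / (1 - Cmod Q) ^ 2 * Cmod (Q ^ n))%R) in *.
    assert (K0 : (0 <= k)%R).
    { eapply Rle_trans; [apply Cmod_ge_0 | exact R1]. }
    assert (B0 := cubic_majorant_pos n).
    assert (Hk2 : (2 * k <= M * r ^ n)%R) by lra.
    split.
    + rewrite Cmod_mult. apply Rmult_le_compat; try apply Cmod_ge_0; lra.
    (* Product rule for the difference: each summand is at most $|x|\,k$ times the majorant, and
       $2k\le Mr^n$. *)
    + replace (cubic_term Q x n * cubic_ratio Q x (Q ^ n)
               - cubic_term Q 0 n * cubic_ratio Q 0 (Q ^ n))
        with ((cubic_term Q x n - cubic_term Q 0 n) * cubic_ratio Q 0 (Q ^ n)
              + cubic_term Q x n * (cubic_ratio Q x (Q ^ n) - cubic_ratio Q 0 (Q ^ n)))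
        by ring.
      destruct (Cmod_cubic_ratio 0 (Q ^ n)) as [R0 _];
        [rewrite Cmod_0; lra | apply Cmod_Qpow_le1 |]. fold k in R0.
      eapply Rle_trans; [apply Cmod_triangle|]. rewrite !Cmod_mult.
      apply Rle_trans with (Cmod x * cubic_majorant n * k + cubic_majorant n * (Cmod x * k))%R.
      * apply Rplus_le_compat; apply Rmult_le_compat; try apply Cmod_ge_0; assumption.
      * replace (Cmod x * cubic_majorant n * k + cubic_majorant n * (Cmod x * k))%R
          with (Cmod x * (cubic_majorant n * (2 * k)))%R by ring.
        apply Rmult_le_compat_l; [exact X0|]. apply Rmult_le_compat_l; lra.
Qed.

(** * The sum as a function of $x$ *)

Lemma cubic_sum_Ccv (x : C) : (Cmod x <= 1)%R ->
  Ccv (sum_n (G := C_NormedModule) (cubic_term Q x)) (cubic_sum Q x).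
Proof.
  intros Hx.
  destruct (Ccv_of_majorant (cubic_term Q x) cubic_majorant) as [l Hl].
  - intros n. now apply cubic_term_bounds.
  - apply ex_series_cubic_majorant.
  - exact (Ccv_lim _ l Hl).
Qed.

(** The limit of [cubic_telescope]: the certificate is a bounded multiple of the $n$-th term, so it
    tends to 0. *)
Lemma cubic_sum_step (x : C) : (Cmod x <= 1)%R ->
  cubic_sum Q x = cubic_factor Q x * cubic_sum Q (x * Q ^ 2).
Proof.
  intros Hx.
  assert (Hx2 : (Cmod (x * Q ^ 2) <= 1)%R) by le1.
  apply Ccv_unique with (u := sum_n (G := C_NormedModule) (cubic_term Q x));
    [now apply cubic_sum_Ccv|].
  set (cert := fun n => sum_n (G := C_NormedModule) (cubic_term Q x) n
    - cubic_factor Q x * sum_n (G := C_NormedModule) (cubic_term Q (x * Q ^ 2)) n).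
  assert (Hcert : Ccv cert 0).
  (* The 4 bounds $|1-xy|\,|1-xQ^2y|$, with $|xQy|\le 1$; each of the two denominator factors has
     modulus at least $1-|Q|$. *)
  { apply Ccv_squeeze with (b := fun n => (4 * / (1 - Cmod Q) ^ 2 * cubic_majorant n)%R).
    - intros n. unfold cert. rewrite cubic_telescope by exact Hx.
      assert (Hy := Cmod_Qpow_le1 n). set (y := Q ^ n) in *. clearbody y.
      match goal with |- Rle (Cmod (Cminus ?e _)) _ => replace (e - 0) with e by ring end.
      rewrite Cmod_mult.
      apply Rmult_le_compat; try apply Cmod_ge_0; [|now apply cubic_term_bounds].
      neq (1 - x ^ 2 * Q * y ^ 2) (x ^ 2 * y ^ 2).
      neq (1 - x ^ 2 * Q ^ 3 * y ^ 2) (x ^ 2 * Q * Q * y ^ 2).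
      unfold Cdiv. rewrite Cmod_mult.
      apply Rmult_le_compat; try apply Cmod_ge_0.
      + rewrite !Cmod_mult.
        assert (A : (Cmod (1 - x * y) <= 2)%R) by (apply Cmod_one_minus_le; le1).
        assert (B : (Cmod (1 - x * Q ^ 2 * y) <= 2)%R) by (apply Cmod_one_minus_le; le1).
        assert (D : (Cmod (x * Q * y) <= 1)%R) by le1. rewrite !Cmod_mult in D.
        assert (A0 := Cmod_ge_0 (1 - x * y)).
        assert (B0 := Cmod_ge_0 (1 - x * Q ^ 2 * y)).
        assert (D0 : (0 <= Cmod x * Cmod Q * Cmod y)%R)
          by (rewrite <- !Cmod_mult; apply Cmod_ge_0).
        assert (E : (Cmod x * Cmod Q * Cmod y * Cmod (1 - x * y) <= 2)%R) by nra.
        assert (E0 : (0 <= Cmod x * Cmod Q * Cmod y * Cmod (1 - x * y))%R)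
          by now apply Rmult_le_pos.
        nra.
      + rewrite Cmod_inv by now apply Cmult_neq_0.
        apply Rinv_le_contravar; [apply pow_lt; lra|].
        rewrite Cmod_mult. simpl (_ ^ 2)%R. rewrite Rmult_1_r.
        apply Rmult_le_compat; try lra.
        * replace (x ^ 2 * Q * y ^ 2) with (Q * (x ^ 2 * y ^ 2)) by ring. apply Cmod_one_minus_Q_ge; le1.
        * replace (x ^ 2 * Q ^ 3 * y ^ 2) with (Q * (x ^ 2 * Q * Q * y ^ 2)) by ring.
          apply Cmod_one_minus_Q_ge; le1.
    - replace (Finite 0) with (Rbar_mult (Finite (4 * / (1 - Cmod Q) ^ 2)%R) (Finite 0))
        by (simpl; f_equal; ring).
      apply is_lim_seq_scal_l. apply ex_series_lim_0, ex_series_cubic_majorant. }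
  replace (cubic_factor Q x * cubic_sum Q (x * Q ^ 2))
    with (cubic_factor Q x * cubic_sum Q (x * Q ^ 2) + 0) by ring.
  apply (Ccv_ext (fun n => cubic_factor Q x
    * sum_n (G := C_NormedModule) (cubic_term Q (x * Q ^ 2)) n + cert n)).
  { intros n. unfold cert. ring. }
  apply Ccv_plus; [|exact Hcert].
  apply Ccv_mult; [apply Ccv_const | now apply cubic_sum_Ccv].
Qed.

(** The $k$-th application, at $xQ^{2k}$, contributes the factors of index $2k$ and $2k+1$ of
    $(x^2Q;Q^2)$, hence the length $2k$ on the left against $k$ on the right. *)
Lemma cubic_sum_iterate (x : C) (k : nat) : (Cmod x <= 1)%R ->
  cubic_sum Q x * qpoch (x ^ 2 * Q) (Q ^ 2) (2 * k) =
  qpoch (x * Q) (Q ^ 2) k * qpoch (x ^ 3 * Q ^ 3) (Q ^ 6) k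
    * cubic_sum Q (x * (Q ^ 2) ^ k).
Proof.
  intros Hx. induction k as [|k IH].
  - simpl. replace (x * 1) with x by ring. ring.
  - replace (2 * S k)%nat with (S (S (2 * k))) by lia.
    cbn [qpoch]. rewrite <- Cmult_assoc, Cmult_assoc, IH.
    rewrite (cubic_sum_step (x * (Q ^ 2) ^ k)) by le1.
    replace (x * (Q ^ 2) ^ S k) with (x * (Q ^ 2) ^ k * Q ^ 2) by (rewrite (Cpow_S (Q ^ 2) k); ring).
    rewrite (Cpow_S (Q ^ 2) (2 * k)), (Cpow_mult_r (Q ^ 2) 2 k).
    replace ((Q ^ 6) ^ k) with (((Q ^ 2) ^ k) ^ 3)
      by (rewrite <- !Cpow_mult_r; f_equal; lia).
    replace (((Q ^ 2) ^ 2) ^ k) with (((Q ^ 2) ^ k) ^ 2)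
      by (rewrite <- !Cpow_mult_r; f_equal; lia).
    assert (Hy : (Cmod ((Q ^ 2) ^ k) <= 1)%R) by le1.
    set (y := (Q ^ 2) ^ k) in *. clearbody y. unfold cubic_factor.
    neq (1 - x ^ 2 * Q * y ^ 2) (x ^ 2 * y ^ 2).
    neq (1 - x ^ 2 * Q ^ 3 * y ^ 2) (x ^ 2 * Q * Q * y ^ 2).
    field_neq.
Qed.

(** The termwise Lipschitz bounds add up; this is the continuity at $x=0$ used to pass to the
    limit. *)
Lemma cubic_sum_lipschitz (x : C) : (Cmod x <= 1)%R ->
  (Cmod (cubic_sum Q x - cubic_sum Q 0) <= Cmod x * Series cubic_majorant)%R.
Proof.
  intros Hx. assert (H0 : (Cmod 0 <= 1)%R) by (rewrite Cmod_0; lra).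
  apply Cmod_Ccv_le with (u := fun n =>
    sum_n (G := C_NormedModule) (cubic_term Q x) n
      + - (1) * sum_n (G := C_NormedModule) (cubic_term Q 0) n).
  - replace (cubic_sum Q x - cubic_sum Q 0)
      with (cubic_sum Q x + - (1) * cubic_sum Q 0) by ring.
    apply Ccv_plus; [now apply cubic_sum_Ccv|].
    apply Ccv_mult; [apply Ccv_const | now apply cubic_sum_Ccv].
  - intros n.
    replace (sum_n (G := C_NormedModule) (cubic_term Q x) n
      + - (1) * sum_n (G := C_NormedModule) (cubic_term Q 0) n)
      with (sum_n (G := C_NormedModule) (fun k => cubic_term Q x k - cubic_term Q 0 k) n).
    + eapply Rle_trans.
      { apply sum_n_Cmod_le with (b := fun k => (Cmod x * cubic_majorant k)%R).
        intros k. now apply cubic_term_bounds. }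
      eapply Rle_trans;
        [apply Req_le, (sum_n_mult_l (K := R_AbsRing) (Cmod x) cubic_majorant n)|].
      apply Rmult_le_compat_l; [apply Cmod_ge_0|].
      (* The majorant is positive, so its partial sums increase to [Series cubic_majorant] and stay
         below it. *)
      apply is_lim_seq_incr_compare.
      * apply Series_correct, ex_series_cubic_majorant.
      * intros k. rewrite sum_Sn. change plus with Rplus.
        assert (P := cubic_majorant_pos (S k)). lra.
    + induction n as [|n IH]; [rewrite !sum_O | rewrite !sum_Sn, IH; change plus with Cplus];
        match goal with |- ?l = ?e => change (@eq C l e) end; ring.
Qed.

(** Both sides are limits of the iterated relation as $k\to\infty$: the argument $xQ^{2k}$ tends to
    0 geometrically. *)
Lemma cubic_sum_eq (x : C) : (Cmod x <= 1)%R ->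
  cubic_sum Q x * qpoch_inf (x ^ 2 * Q) (Q ^ 2) =
  qpoch_inf (x * Q) (Q ^ 2) * qpoch_inf (x ^ 3 * Q ^ 3) (Q ^ 6) * cubic_sum Q 0.
Proof.
  intros Hx.
  assert (HQ2 : (Cmod (Q ^ 2) < 1)%R) by now apply Cmod_pow_lt1.
  assert (HQ6 : (Cmod (Q ^ 6) < 1)%R) by now apply Cmod_pow_lt1.
  apply Ccv_unique with
    (u := fun k => cubic_sum Q x * qpoch (x ^ 2 * Q) (Q ^ 2) (2 * k)).
  - apply Ccv_mult; [apply Ccv_const|]. now apply Ccv_double, qpoch_Ccv.
  - apply (Ccv_ext (fun k => qpoch (x * Q) (Q ^ 2) k * qpoch (x ^ 3 * Q ^ 3) (Q ^ 6) k
                             * cubic_sum Q (x * (Q ^ 2) ^ k))).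
    { intros k. symmetry. now apply cubic_sum_iterate. }
    apply Ccv_mult; [apply Ccv_mult; now apply qpoch_Ccv|].
    apply Ccv_squeeze with
      (b := fun k => (Cmod x * Series cubic_majorant * Cmod (Q ^ 2) ^ k)%R).
    + intros k. eapply Rle_trans; [apply cubic_sum_lipschitz; le1|].
      rewrite Cmod_mult, Cmod_pow. apply Req_le. ring.
    + replace (Finite 0)
        with (Rbar_mult (Finite (Cmod x * Series cubic_majorant)%R) (Finite 0))
        by (simpl; f_equal; ring).
      apply is_lim_seq_scal_l, is_lim_seq_geom.
      rewrite Rabs_pos_eq; [exact HQ2 | apply Cmod_ge_0].
Qed.

(** At $x=1$ the first ratio contains $1-xQ^0=0$, so every term after the first vanishes. *)
Lemma cubic_sum_1 : cubic_sum Q 1 = 1.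
Proof.
  assert (Z : forall n, cubic_term Q 1 (S n) = 0).
  { induction n as [|n IH].
    - simpl. unfold cubic_ratio. unfold Cdiv. ring.
    - change (cubic_term Q 1 (S (S n)))
        with (cubic_term Q 1 (S n) * cubic_ratio Q 1 (Q ^ S n)).
      rewrite IH. ring. }
  apply Ccv_unique with (u := sum_n (G := C_NormedModule) (cubic_term Q 1)).
  - apply cubic_sum_Ccv. rewrite Cmod_1. lra.
  - apply (Ccv_ext (fun _ => 1)); [|apply Ccv_const].
    induction n as [|n IH].
    + now rewrite sum_O.
    + rewrite sum_Sn, <- IH, Z. change plus with Cplus. ring.
Qed.

(** At $x=1$ the factor $(Q;Q^2)_\infty$ occurs on both sides of [cubic_sum_eq] and, being nonzero,
    cancels. *)
Lemma cubic_sum_0 : qpoch_inf (Q ^ 3) (Q ^ 6) * cubic_sum Q 0 = 1.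
Proof.
  assert (H : (Cmod 1 <= 1)%R) by (rewrite Cmod_1; lra).
  assert (E := cubic_sum_eq 1 H). rewrite cubic_sum_1 in E.
  replace (1 ^ 2 * Q) with Q in E by ring. replace (1 * Q) with Q in E by ring.
  replace (1 ^ 3 * Q ^ 3) with (Q ^ 3) in E by ring.
  assert (N : qpoch_inf Q (Q ^ 2) <> 0).
  { apply qpoch_inf_neq0; [exact HQ | now apply Cmod_pow_lt1]. }
  rewrite <- Cmult_assoc in E.
  replace (qpoch_inf (Q ^ 3) (Q ^ 6) * cubic_sum Q 0)
    with (/ qpoch_inf Q (Q ^ 2)
          * (qpoch_inf Q (Q ^ 2) * (qpoch_inf (Q ^ 3) (Q ^ 6) * cubic_sum Q 0)))
    by (field; exact N).
  rewrite <- E. field. exact N.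
Qed.

End CubicSeries.

(** * Specialisation to $x=q$, $Q=q^3$ *)

Lemma binom_1_r (n : nat) : binom n 1 = n.
Proof.
  induction n as [|n IH]; [reflexivity|].
  change (binom (S n) 1) with (binom n 0 + binom n 1)%nat. rewrite IH.
  destruct n; reflexivity.
Qed.

(* When [x ^ 3 = Q], the factor [x - Q ^ (2 j + 2)] equals [x (1 - x ^ 2 Q ^ (2 j + 1))]. *)
Lemma cubic_term_diag (q : C) (n : nat) : (Cmod q < 1)%R ->
  cubic_term (q ^ 3) q n =
  (-1) ^ n * q ^ (3 * binom n 2 + 4 * n) * qpoch q (q ^ 3) n / qpoch (q ^ 9) (q ^ 9) n.
Proof.
  intros Hq. induction n as [|n IH].
  - simpl. field.
  - change (cubic_term (q ^ 3) q (S n))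
      with (cubic_term (q ^ 3) q n * cubic_ratio (q ^ 3) q ((q ^ 3) ^ n)).
    rewrite IH. cbn [qpoch].
    assert (H9 : (Cmod (q ^ 9) < 1)%R) by now apply Cmod_pow_lt1.
    assert (N := qpoch_neq0 (q ^ 9) (q ^ 9) n H9 H9).
    replace (3 * binom (S n) 2 + 4 * S n)%nat
      with (3 * binom n 2 + 4 * n + (4 + 3 * n))%nat
      by (change (binom (S n) 2) with (binom n 1 + binom n 2)%nat; rewrite binom_1_r; lia).
    rewrite !Cpow_add_r, (Cpow_S (-1) n), (Cpow_mult_r q 3 n).
    replace ((q ^ 9) ^ n) with (((q ^ 3) ^ n) ^ 3)
      by (rewrite <- !Cpow_mult_r; f_equal; lia).
    assert (Hy : (Cmod ((q ^ 3) ^ n) <= 1)%R) by (rewrite <- Cpow_mult_r; apply Cmod_pow_le1; lra).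
    set (y := (q ^ 3) ^ n) in *. clearbody y. unfold cubic_ratio.
    assert (N1 : 1 - q ^ 9 * y ^ 3 <> 0).
    { apply one_minus_neq0, Cmod_mult_lt1; [exact H9 | now apply Cmod_pow_le1]. }
    (* This is $1-x^2Qy^2$ at $x=q$, $Q=q^3$, the factor that cancels. *)
    assert (N2 : 1 - q ^ 5 * y ^ 2 <> 0).
    { apply one_minus_neq0, Cmod_mult_lt1; [now apply Cmod_pow_lt1 | now apply Cmod_pow_le1]. }
    field. repeat split; try assumption.
    intros H. apply N2. rewrite <- H. ring.
Qed.

Theorem theorem1p2 (q : C) (hq : (Cmod q < 1)%R) :
  is_series
    (fun n : nat =>
       ((-1) ^ n * q ^ (3 * binom n 2 + 4 * n) * qpoch q (q ^ 3) n
          / qpoch (q ^ 9) (q ^ 9) n)%C)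
    ((qpoch_inf (q ^ 4) (q ^ 6) * qpoch_inf (q ^ 12) (q ^ 18))
       / (qpoch_inf (q ^ 5) (q ^ 6) * qpoch_inf (q ^ 9) (q ^ 18)))%C.
Proof.
  assert (H3 : (Cmod (q ^ 3) < 1)%R) by now apply Cmod_pow_lt1.
  assert (H1 : (Cmod q <= 1)%R) by lra.
  apply (is_series_ext (V := C_NormedModule) (cubic_term (q ^ 3) q)).
  { intros n. now apply cubic_term_diag. }
  (* With $x=q$ and $Q=q^3$, the parameters $x^2Q$, $xQ$, $x^3Q^3$ become $q^5$, $q^4$, $q^{12}$ and
     the bases become $q^6$ and $q^{18}$; [E0] supplies the remaining $(q^9;q^{18})_\infty$. *)
  assert (E := cubic_sum_eq (q ^ 3) H3 q H1). assert (E0 := cubic_sum_0 (q ^ 3) H3).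
  replace (q ^ 2 * q ^ 3) with (q ^ 5) in E by ring.
  replace (q * q ^ 3) with (q ^ 4) in E by ring.
  replace (q ^ 3 * (q ^ 3) ^ 3) with (q ^ 12) in E by ring.
  replace ((q ^ 3) ^ 2) with (q ^ 6) in E by ring.
  replace ((q ^ 3) ^ 6) with (q ^ 18) in E, E0 by ring.
  replace ((q ^ 3) ^ 3) with (q ^ 9) in E0 by ring.
  assert (N5 : qpoch_inf (q ^ 5) (q ^ 6) <> 0)
    by (apply qpoch_inf_neq0; now apply Cmod_pow_lt1).
  assert (N9 : qpoch_inf (q ^ 9) (q ^ 18) <> 0)
    by (apply qpoch_inf_neq0; now apply Cmod_pow_lt1).
  replace (qpoch_inf (q ^ 4) (q ^ 6) * qpoch_inf (q ^ 12) (q ^ 18)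
           / (qpoch_inf (q ^ 5) (q ^ 6) * qpoch_inf (q ^ 9) (q ^ 18)))
    with (cubic_sum (q ^ 3) q).
  - apply Ccv_filterlim. now apply cubic_sum_Ccv.
  - replace (cubic_sum (q ^ 3) q)
      with (cubic_sum (q ^ 3) q * qpoch_inf (q ^ 5) (q ^ 6) / qpoch_inf (q ^ 5) (q ^ 6))
      by (field; exact N5).
    rewrite E.
    replace (cubic_sum (q ^ 3) 0) with (/ qpoch_inf (q ^ 9) (q ^ 18)).
    + field. now split.
    + replace (cubic_sum (q ^ 3) 0)
        with (/ qpoch_inf (q ^ 9) (q ^ 18) * (qpoch_inf (q ^ 9) (q ^ 18) * cubic_sum (q ^ 3) 0))
        by (field; exact N9).
      rewrite E0. ring.
Qed.
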